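(* For all positive integers $n,N$ with $n<N<\left\lfloor\frac{5}{2}n\right\rfloor-1$, \[ st(n,N)\leq\left\lceil\frac{2n+N-2}{3}\right\rceil. \]
   Context: Let $M$ be a matrix with entries in $\{0,1\}$; rows are indexed from top to bottom and columns from left to right. For $c\in\{0,1\}$, a $c$-staircase in $M$ is a sequence $s_1,\dots,s_\ell$ of entries (positions) of $M$, all with value $c$, such that for each $i=1,\dots,\ell-1$ the entry $s_{i+1}$ is either strictly to the right of $s_i$ in the same row, or strictly below $s_i$ in the same column ($s_i$ and $s_{i+1}$ need not be neighbouring positions). Its length is $\ell$, the number of its elements. A homogeneous staircase is a $0$-staircase or a $1$-staircase. $st(M)$ denotes the maximum length of a homogeneous staircase in $M$, and \[ st(n,N)=\min\{st(M): M\in\{0,1\}^{n\times N}\}, \] where $\{0,1\}^{n\times N}$ is the set of $0$-$1$ matrices with $n$ rows and $N$ columns. *)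

(* Defs.v *)
From HB Require Import structures.
From mathcomp Require Import all_boot all_order all_algebra.

Set Implicit Arguments.
Unset Strict Implicit.
Unset Printing Implicit Defensive.

(* A 0-1 matrix with n rows and N columns is an M : 'M[bool]_(n, N), with
   [false] for 0 and [true] for 1; row indices increase downwards and column
   indices increase to the right. *)

Section Staircases.
Variables n N : nat.
Implicit Types (M : 'M[bool]_(n, N)) (p q : 'I_n * 'I_N) (c : bool).

Definition stair_step : rel ('I_n * 'I_N) := fun p q =>
  ((q.1 == p.1) && (p.2 < q.2)) || ((q.2 == p.2) && (p.1 < q.1)).

Definition staircase M c (s : seq ('I_n * 'I_N)) : bool :=
  all (fun p => M p.1 p.2 == c) s && sorted stair_step s.

Definition homogeneous_staircase M (s : seq ('I_n * 'I_N)) : bool :=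
  staircase M false s || staircase M true s.

Definition has_staircase M : pred nat := fun l =>
  [exists s : l.-tuple ('I_n * 'I_N), homogeneous_staircase M s].

Lemma has_staircase0 M : exists l, has_staircase M l.
Proof. by exists 0; apply/existsP; exists [tuple]. Qed.

Lemma has_staircase_bound M l : has_staircase M l -> l <= n * N.
Proof.
case/existsP=> s hs.
have srt : sorted stair_step s by case/orP: hs => /andP[].
have srt' : sorted ltn [seq (p.1 + p.2)%N | p : 'I_n * 'I_N <- s].
  rewrite sorted_map; apply: sub_sorted srt => p q /=.
  by case/orP=> /andP[/eqP-> lt]; rewrite ?ltn_add2l ?ltn_add2r.
have us : uniq s by apply: map_uniq (sorted_uniq ltn_trans ltnn srt').
have := max_card (mem s).
by rewrite (card_uniqP us) size_tuple card_prod !card_ord.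
Qed.

Definition st_mx M : nat :=
  ex_maxn (has_staircase0 M) (@has_staircase_bound M).

End Staircases.

Definition st (n N : nat) : nat :=
  st_mx [arg min_(M < (const_mx false : 'M[bool]_(n, N))) st_mx M].

Lemma st_mxP n N (M : 'M[bool]_(n, N)) :
  (exists2 s, homogeneous_staircase M s & size s = st_mx M) /\
  (forall s, homogeneous_staircase M s -> size s <= st_mx M).
Proof.
rewrite /st_mx; case: ex_maxnP => l /existsP[s hs] lmax; split.
  by exists s; rewrite ?size_tuple.
by move=> t ht; apply: lmax; apply/existsP; exists (in_tuple t).
Qed.

Lemma stP n N :
  (exists M : 'M[bool]_(n, N), st_mx M = st n N) /\
  (forall M : 'M[bool]_(n, N), st n N <= st_mx M).
Proof.
rewrite /st; case: arg_minnP => // M _ Mmin.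
by split=> [|M']; [exists M | apply: Mmin].
Qed.

(* Main.v *)
Require Import Defs.
From HB Require Import structures.
From mathcomp Require Import all_boot all_order all_algebra.
From mathcomp Require Import zify lra.
Set Implicit Arguments.
Unset Strict Implicit.
Unset Printing Implicit Defensive.
Import Order.TTheory GRing.Theory Num.Theory.
Local Open Scope ring_scope.

(** Every step of a staircase increases i + j, so a region lying in a band
    u <= i + j < v (a strip of antidiagonals) holds a staircase of length at
    most v - u.  The extremal matrices cut the rows into an upper and a lower
    part, each sliced into three bands of alternating colours:

        rows i < h :    1 if i + j < a,   0 if a <= i + j < a + L,   1 beyond;
        rows i >= h :   0 if i + j < L,   1 if L <= i + j < 2 L,     0 beyond,

    where L is the intended bound and a = L - n + 1.  The two middle bands have
    width L.  The offset n - 1 between a and L, and between a + L and 2 L, is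
    the largest possible difference of two row indices, so no column meets both
    the first band of the upper part and the middle band of the lower part,
    nor both the middle band of the upper part and the last band of the lower
    part.  A monochromatic staircase that changes bands thus jumps over a whole
    middle band or drops from the upper part to the lower part with i + j still
    increasing.  Subtracting from i + j a constant that depends on the band
    only gives, for each colour, a rank that increases along staircases
    ([band_rank_step]) and takes its values in [0, L) ([band_rank_lt]).  The
    second property follows from 2 n + N - 2 <= 3 L and from each part having
    at most 2 L - N + 1 rows; for two parts of nearly equal height these
    inequalities hold with L the ceiling of (2 n + N - 2) / 3, as long as
    2 N + 4 <= 5 n, and n < N makes a positive. *)

Lemma staircase_size_le_rank n N (M : 'M[bool]_(n, N)) c L
    (rank : 'I_n * 'I_N -> nat) s :
    (forall p, M p.1 p.2 = c -> rank p < L)%N ->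
    (forall p q, M p.1 p.2 = c -> M q.1 q.2 = c ->
      stair_step p q -> rank p < rank q)%N ->
  staircase M c s -> (size s <= L)%N.
Proof.
move=> rank_lt rank_step /andP[s_c s_sorted].
have ranks_sorted : sorted ltn (map rank s).
  rewrite sorted_map; apply: (sub_in_sorted _ s_c s_sorted) => p q.
  by move=> /eqP Mp /eqP Mq; apply: rank_step.
have ranks_uniq := sorted_uniq ltn_trans ltnn ranks_sorted.
rewrite -(size_map rank) -[leqRHS](size_iota 0).
apply: uniq_leq_size => // _ /mapP[p /(allP s_c)/eqP Mp ->].
by rewrite mem_iota rank_lt.
Qed.

Lemma st_le_of_matrix n N (M : 'M[bool]_(n, N)) L :
    (forall c s, staircase M c s -> size s <= L)%N ->
  (st n N <= L)%N.
Proof.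
move=> size_le; apply: leq_trans ((stP n N).2 M) _.
by have [[s + <-] _] := st_mxP M; case/orP; apply: size_le.
Qed.

Section BandMatrix.
Variables n N L h : nat.
Let a := (L - n).+1.
Implicit Types (p q : 'I_n * 'I_N) (c : bool).

Definition band_color (i j : nat) : bool :=
  if (i < h)%N then ~~ (a <= i + j < a + L)%N else (L <= i + j < L + L)%N.

Definition band_mx : 'M[bool]_(n, N) := \matrix_(i, j) band_color i j.

(** The cells of colour 1 use i + j itself on the first upper band, and shift
    the two later bands down by L, the width of the band of colour 0 that is
    jumped over.  For colour 0, the shift of the lower first band is at most h,
    since that band starts at i + j = h, and at most a, the shift of the upper
    middle band from which it can be entered; the last band lies beyond a middle
    band of width L, which gives the extra shift by L. *)
Definition band_rank c p : nat :=
  let d := (p.1 + p.2)%N in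
  if c then if (p.1 < h)%N && (d < a)%N then d else (d - L)%N
  else if (p.1 < h)%N then (d - a)%N
  else if (d < L)%N then (d - minn a h)%N else (d - (L + minn a h))%N.

Hypothesis le_nL : (n <= L)%N.

Lemma band_rank_lt c p :
    (N + 2 * n <= 3 * L + 2)%N ->
    (N + h <= 2 * L + 1)%N -> (N + n <= 2 * L + 1 + h)%N ->
  band_mx p.1 p.2 = c -> (band_rank c p < L)%N.
Proof.
case: p => i j /=; rewrite /band_rank /= mxE /band_color /a.
have := ltn_ord i; have := ltn_ord j.
move: (nat_of_ord i) (nat_of_ord j) => {}i {}j.
by case: c; do ?[case: ifP => /=]; lia.
Qed.

Lemma band_rank_step c p q :
    band_mx p.1 p.2 = c -> band_mx q.1 q.2 = c ->
  stair_step p q -> (band_rank c p < band_rank c q)%N.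
Proof.
case: p q => [i j] [i' j'] /=.
rewrite /stair_step /band_rank /= !mxE /band_color /a -!val_eqE /=.
have := ltn_ord i; have := ltn_ord j.
have := ltn_ord i'; have := ltn_ord j'.
move: (nat_of_ord i) (nat_of_ord j) (nat_of_ord i') (nat_of_ord j').
move=> {}i {}j {}i' {}j'.
by case: c; do ?[case: ifP => /=]; lia.
Qed.

End BandMatrix.

Lemma st_le_bands n N L h :
    (n <= L)%N -> (N + 2 * n <= 3 * L + 2)%N ->
    (N + h <= 2 * L + 1)%N -> (N + n <= 2 * L + 1 + h)%N ->
  (st n N <= L)%N.
Proof.
move=> le_nL le_L le_h le_h'; apply: (@st_le_of_matrix _ _ (band_mx n N L h)).
move=> c s; apply: (@staircase_size_le_rank _ _ _ _ _ (band_rank L h c)).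
  by move=> p; apply: band_rank_lt.
by move=> p q; apply: band_rank_step.
Qed.

(** The ceiling of (2 n + N - 2) / 3 is the quotient of 2 n + N by 3.  With the
    rows cut in the middle, the larger part has the ceiling of n / 2 rows, and
    2 N + 4 <= 5 n gives room for them in both parities of n. *)
Lemma st_le_third n N :
    (n < N)%N -> (2 * N + 4 <= 5 * n)%N ->
  (st n N <= (2 * n + N) %/ 3)%N.
Proof. by move=> ltnN leN; apply: (@st_le_bands _ _ _ n./2); lia. Qed.

Theorem corollary11 (n N : nat) (n_gt0 : (0 < n)%N) (N_gt0 : (0 < N)%N)
    (lt_nN : (n < N)%N)
    (lt_N : N%:Z < Num.floor (5 / 2 * n%:R : rat) - 1) :
  (st n N)%:Z <= Num.ceil ((2 * n%:R + N%:R - 2) / 3 : rat).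
Proof.
have leN : (2 * N + 4 <= 5 * n)%N.
  have : (N + 2)%:Z <= Num.floor (5 / 2 * n%:R : rat) by lia.
  rewrite floor_ge_int // => leN_rat.
  have : (2 * N + 4)%:R <= (5 * n)%:R :> rat.
    by move: leN_rat; rewrite pmulrn natrD; lra.
  by rewrite ler_nat.
apply: (@le_trans _ _ ((2 * n + N) %/ 3)%:Z).
  by rewrite lez_nat; apply: st_le_third.
(* z <= ceil x means z - 1 < x, which for z = (2 n + N) %/ 3 reads
   3 z < 2 n + N + 1. *)
rewrite -ltzD1 -ltrBlDr ceil_gt_int.
have : (3 * ((2 * n + N) %/ 3))%:R <= (2 * n + N)%:R :> rat.
  by rewrite ler_nat; lia.
rewrite intrD -pmulrn natrM natrD natrM; lra.
Qed.
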